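(* Let $p(x)=40x^4-30x^2+2$ and $q(x)=75x^9-150x^7+88x^5-10x^3-3x$, and consider the polynomial Abel differential equation \[ \frac{dy}{dx}=p(x)\,y^2+q(x)\,y^3 \] on the interval $[a,b]=[-1,1]$. Then this equation has a center in $[-1,1]$, and it does not satisfy the composition condition.
   Context: For real polynomials $p,q\in\mathbb{R}[x]$ and a real interval $[a,b]$, the polynomial Abel equation $dy/dx=p(x)y^2+q(x)y^3$ (with $y$ real) has a center in $[a,b]$ if there is a neighborhood of $0$ such that every solution $y(x)$ with $y(a)$ in this neighborhood is defined on $[a,b]$ and satisfies $y(a)=y(b)$. For a continuous function $c$, write $\tilde c(x)=\int_a^x c(\sigma)\,d\sigma$. The equation satisfies the composition condition on $[a,b]$ if there exist real polynomials $w,p_1,q_1\in\mathbb{R}[x]$ with $w(a)=w(b)$ such that $\tilde p(x)=p_1(w(x))$ and $\tilde q(x)=q_1(w(x))$ for all $x$. Here $a=-1$, $b=1$. *)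

(* Defs.v *)
From Stdlib Require Import Reals List.
Open Scope R_scope.

Fixpoint peval (l : list R) (x : R) : R :=
  match l with
  | nil => 0
  | c :: l' => c + x * peval l' x
  end.

(* y is a solution on [a,b] of dy/dx = p(x) y^2 + q(x) y^3:
   at every x in [a,b] the derivative of y (one-sided at the endpoints,
   i.e. the difference quotient is taken within [a,b]) exists and equals
   p(x) y(x)^2 + q(x) y(x)^3. *)
Definition abel_solution (p q : R -> R) (a b : R) (y : R -> R) : Prop :=
  forall x, a <= x <= b ->
    forall eps, 0 < eps -> exists d, 0 < d /\
      forall h, h <> 0 -> Rabs h < d -> a <= x + h <= b ->
        Rabs ((y (x + h) - y x) / h - (p x * (y x)^2 + q x * (y x)^3)) < eps.

Definition has_center (p q : R -> R) (a b : R) : Prop :=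
  exists delta, 0 < delta /\
    forall y0, Rabs y0 < delta ->
      (exists y, abel_solution p q a b y /\ y a = y0) /\
      (forall y, abel_solution p q a b y -> y a = y0 -> y a = y b).

Definition is_integral (c : R -> R) (a x v : R) : Prop :=
  exists pr : Riemann_integrable c a x, RiemannInt pr = v.

Definition composition_condition (p q : R -> R) (a b : R) : Prop :=
  exists w p1 q1 : list R,
    peval w a = peval w b /\
    forall x,
      (forall v, is_integral p a x v -> v = peval p1 (peval w x)) /\
      (forall v, is_integral q a x v -> v = peval q1 (peval w x)).

Definition p_ex (x : R) : R := 40 * x^4 - 30 * x^2 + 2.
Definition q_ex (x : R) : R :=
  75 * x^9 - 150 * x^7 + 88 * x^5 - 10 * x^3 - 3 * x.

(* Main.v *)
(** With [z = 1 / y] the equation has the invariant curves [z^2 b = 0] and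
    [z^2 c = 0], where [b = 1 + b1(x) y + b0(x) y^2] and
    [c = 1 + c1(x) y + c0(x) y^2] are the polynomials below; their cofactors are
    in ratio 3 : 4, so [c^3 y^2 / b^4] is a rational first integral.  Its square
    root [Phi = y c^(3/2) / b^2] has positive derivative in [y] near [y = 0], and
    [b = c = 1] at [x = -1] and [x = 1], so that [Phi(-1, y) = Phi(1, y) = y].
    Hence the level curves of [Phi] are solutions with equal values at both
    ends, and by uniqueness there are no others.

    If the composition condition held, [P] and [Q] (the primitives of [p] and
    [q]) would be functions of a continuous [w] with [w(-1) = w(1)].  One of
    [w(0)], [w(4/5)], [w(1)] lies between the two others, and the intermediate
    value theorem gives a second point with the same value of [w], hence of [P]
    and [Q]; in each of the three cases no such point exists. *)

Require Import Defs.
From Stdlib Require Import Reals List Ranalysis5 Lra.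
From Coquelicot Require Import Coquelicot.
Open Scope R_scope.

(** * Solutions with given initial value *)

(** Projection onto [[a, b]]: composing with it extends a solution by constants to the whole line,
    so that theorems on two-sided continuity apply at the endpoints. *)
Definition clamp (a b x : R) : R := Rmax a (Rmin b x).

Lemma clamp_in (a b x : R) : a <= b -> a <= clamp a b x <= b.
Proof.
  intros H; unfold clamp, Rmax, Rmin.
  destruct (Rle_dec b x), (Rle_dec a _); lra.
Qed.

Lemma clamp_id (a b x : R) : a <= x <= b -> clamp a b x = x.
Proof.
  intros H; unfold clamp, Rmax, Rmin.
  destruct (Rle_dec b x), (Rle_dec a _); lra.
Qed.

Lemma clamp_contract (a b x x' : R) :
  a <= b -> Rabs (clamp a b x - clamp a b x') <= Rabs (x - x').
Proof.
  intros H; unfold clamp, Rmax, Rmin.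
  destruct (Rle_dec b x), (Rle_dec b x'); repeat destruct (Rle_dec a _);
    unfold Rabs; repeat destruct Rcase_abs; lra.
Qed.

(** Near [c = clamp a b x] the difference quotients of [y] are bounded by [Rabs s + 1], where [s] is
    the slope at [c], and [clamp] does not increase distances. *)
Lemma abel_solution_clamp_continuous (p q : R -> R) (a b : R) (y : R -> R) (x : R) :
  a <= b -> abel_solution p q a b y ->
  continuity_pt (fun t => y (clamp a b t)) x.
Proof.
  intros Hab Hy eps Heps.
  set (c := clamp a b x).
  assert (Hc : a <= c <= b) by now apply clamp_in.
  destruct (Hy c Hc 1 Rlt_0_1) as [d [Hd Hh]].
  set (s := p c * y c ^ 2 + q c * y c ^ 3) in Hh.
  assert (Hs := Rabs_pos s).
  assert (He : 0 < eps / (Rabs s + 1)) by (apply Rdiv_lt_0_compat; lra).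
  exists (Rmin d (eps / (Rabs s + 1))); split.
  { now apply Rmin_pos. }
  intros x' [_ Hx']; simpl in Hx'; unfold R_dist in Hx'; simpl; unfold R_dist.
  fold c.
  assert (Hcx := clamp_contract a b x' x Hab); fold c in Hcx.
  assert (Hc' := clamp_in a b x' Hab).
  set (h := clamp a b x' - c) in *.
  replace (clamp a b x') with (c + h) in * by (unfold h; ring).
  destruct (Req_dec h 0) as [H0 | H0].
  { rewrite H0, Rplus_0_r, Rminus_diag, Rabs_R0; exact Heps. }
  assert (M1 := Rmin_l d (eps / (Rabs s + 1))).
  assert (M2 := Rmin_r d (eps / (Rabs s + 1))).
  specialize (Hh h H0 ltac:(lra) Hc').
  replace (y (c + h) - y c) with (h * ((y (c + h) - y c) / h)) by (field; exact H0).
  rewrite Rabs_mult.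
  assert (Hq : Rabs ((y (c + h) - y c) / h) <= Rabs s + 1).
  { replace ((y (c + h) - y c) / h) with (s + ((y (c + h) - y c) / h - s)) by ring.
    eapply Rle_trans; [apply Rabs_triang | lra]. }
  apply Rle_lt_trans with (Rabs h * (Rabs s + 1)).
  { apply Rmult_le_compat_l; [apply Rabs_pos | exact Hq]. }
  replace eps with (eps / (Rabs s + 1) * (Rabs s + 1)) by (field; lra).
  apply Rmult_lt_compat_r; lra.
Qed.

Lemma abel_solution_clamp_derive (p q : R -> R) (a b : R) (y : R -> R) (x : R) :
  a < x < b -> abel_solution p q a b y ->
  is_derive (fun t => y (clamp a b t)) x (p x * y x ^ 2 + q x * y x ^ 3).
Proof.
  intros Hx Hy.
  apply is_derive_Reals; intros eps Heps.
  destruct (Hy x ltac:(lra) eps Heps) as [d [Hd Hh]].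
  assert (Hm : 0 < Rmin d (Rmin (x - a) (b - x))).
  { repeat apply Rmin_pos; lra. }
  exists (mkposreal _ Hm); simpl; intros h Hh0 Hhd.
  assert (M1 := Rmin_l d (Rmin (x - a) (b - x))).
  assert (M2 := Rmin_r d (Rmin (x - a) (b - x))).
  assert (M3 := Rmin_l (x - a) (b - x)).
  assert (M4 := Rmin_r (x - a) (b - x)).
  assert (Hxh : a <= x + h <= b).
  { revert Hhd; unfold Rabs; destruct Rcase_abs; lra. }
  rewrite !clamp_id by lra.
  apply Hh; [exact Hh0 | lra | exact Hxh].
Qed.

(* The difference u of two solutions satisfies u' = A u with A continuous, so
   u^2 exp(-2 M (x - a)) is nonincreasing once M bounds A. *)
Lemma abel_solution_unique (p q : R -> R) (a b : R) (y1 y2 : R -> R) :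
  a < b -> continuity p -> continuity q ->
  abel_solution p q a b y1 -> abel_solution p q a b y2 ->
  y1 a = y2 a -> y1 b = y2 b.
Proof.
  intros Hab Hp Hq H1 H2 H0.
  set (z1 := fun t => y1 (clamp a b t)).
  set (z2 := fun t => y2 (clamp a b t)).
  assert (C1 : forall x, continuity_pt z1 x).
  { intros x; apply (abel_solution_clamp_continuous p q); [lra | exact H1]. }
  assert (C2 : forall x, continuity_pt z2 x).
  { intros x; apply (abel_solution_clamp_continuous p q); [lra | exact H2]. }
  (* The quotient of [p z1^2 + q z1^3 - (p z2^2 + q z2^3)] by [z1 - z2], written without
     division. *)
  set (A := (p * (z1 + z2) + q * (z1 * z1 + z1 * z2 + z2 * z2))%F).
  destruct (continuity_ab_maj A a b ltac:(lra)) as [xM [HM _]].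
  { intros x _; unfold A.
    repeat first [apply continuity_pt_plus | apply continuity_pt_mult];
      first [apply C1 | apply C2 | apply Hp | apply Hq]. }
  set (M := A xM) in HM.
  set (U := fun x => (z1 x - z2 x) ^ 2 * exp (- (2 * M * (x - a)))).
  set (dU := fun x => 2 * exp (- (2 * M * (x - a))) * (z1 x - z2 x) ^ 2 * (A x - M)).
  destruct (MVT_gen U a b dU) as [c [Hc HU]].
  - rewrite Rmin_left, Rmax_right by lra; intros x Hx.
    assert (D1 := abel_solution_clamp_derive p q a b y1 x Hx H1).
    assert (D2 := abel_solution_clamp_derive p q a b y2 x Hx H2).
    change (is_derive z1 x (p x * y1 x ^ 2 + q x * y1 x ^ 3)) in D1.
    change (is_derive z2 x (p x * y2 x ^ 2 + q x * y2 x ^ 3)) in D2.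
    assert (E1 : z1 x = y1 x) by (unfold z1; rewrite clamp_id; lra).
    assert (E2 : z2 x = y2 x) by (unfold z2; rewrite clamp_id; lra).
    unfold U, dU.
    clear - D1 D2 E1 E2; clearbody z1 z2 M.
    auto_derive.
    { repeat split; eexists; eassumption. }
    replace (Derive (fun t : R => z1 t) x) with (p x * y1 x ^ 2 + q x * y1 x ^ 3)
      by (symmetry; exact (is_derive_unique _ _ _ D1)).
    replace (Derive (fun t : R => z2 t) x) with (p x * y2 x ^ 2 + q x * y2 x ^ 3)
      by (symmetry; exact (is_derive_unique _ _ _ D2)).
    unfold A, plus_fct, mult_fct; rewrite E1, E2; unfold Rminus; ring.
  - intros x _; unfold U.
    apply continuity_pt_mult.
    + apply (continuity_pt_ext (fun x => (z1 - z2)%F x * (z1 - z2)%F x)).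
      { intros t; unfold minus_fct; ring. }
      apply continuity_pt_mult; apply continuity_pt_minus; auto.
    + apply derivable_continuous_pt; reg.
  - rewrite Rmin_left, Rmax_right in Hc by lra.
    assert (Ha : U a = 0).
    { unfold U, z1, z2; rewrite clamp_id by lra; rewrite H0; ring. }
    assert (Hdc : dU c <= 0).
    { unfold dU.
      assert (HAc := HM c Hc).
      assert (He := exp_pos (- (2 * M * (c - a)))).
      assert (Hs := pow2_ge_0 (z1 c - z2 c)).
      assert (0 <= 2 * exp (- (2 * M * (c - a))) * (z1 c - z2 c) ^ 2)
        by (apply Rmult_le_pos; lra).
      nra. }
    assert (Hb : U b <= 0) by nra.
    assert (He := exp_pos (- (2 * M * (b - a)))).
    unfold U, z1, z2 in Hb; rewrite clamp_id in Hb by lra.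
    assert (Hs := pow2_ge_0 (y1 b - y2 b)).
    assert ((y1 b - y2 b) ^ 2 = 0) by nra.
    nra.
Qed.

(** The mean value theorem on each side of 0 gives [f r >= m r] and [f (- r) <= - m r]; the
    intermediate value theorem reaches every level between. The informative sigma type lets the
    level curve be defined as a function of [x]. *)
Lemma increasing_level (f df : R -> R) (m r k : R) :
  0 < m -> 0 < r -> f 0 = 0 ->
  (forall y, Rabs y <= r -> is_derive f y (df y) /\ m <= df y) ->
  Rabs k < m * r -> {y : R | Rabs y <= r /\ f y = k}.
Proof.
  intros Hm Hr H0 Hf Hk.
  assert (Hin : forall y, - r <= y <= r -> Rabs y <= r).
  { intros y Hy; apply Rabs_le; lra. }
  assert (Hcont : forall y, - r <= y <= r -> continuity_pt f y).
  { intros y Hy; apply derivable_continuous_pt.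
    exists (df y); apply is_derive_Reals, Hf, Hin, Hy. }
  assert (Hup : m * r <= f r).
  { destruct (MVT_gen f 0 r df) as [c [Hc E]];
      rewrite ?Rmin_left, ?Rmax_right in * by lra.
    - intros y Hy; apply Hf, Hin; lra.
    - intros y Hy; apply Hcont; lra.
    - destruct (Hf c) as [_ Hmc]; [apply Hin; lra | nra]. }
  assert (Hdn : f (- r) <= - (m * r)).
  { destruct (MVT_gen f (- r) 0 df) as [c [Hc E]];
      rewrite ?Rmin_left, ?Rmax_right in * by lra.
    - intros y Hy; apply Hf, Hin; lra.
    - intros y Hy; apply Hcont; lra.
    - destruct (Hf c) as [_ Hmc]; [apply Hin; lra | nra]. }
  apply Rabs_def2 in Hk.
  destruct (IVT_interv (fun y => f y - k) (- r) r) as [y [Hy E]]; try lra.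
  { intros y Hy; apply continuity_pt_minus; [now apply Hcont |].
    apply continuity_pt_const; intros ? ?; reflexivity. }
  exists y; split; [now apply Hin | lra].
Qed.

(** An implicit function argument that also covers the endpoints. With [y = Y x] and
    [y' = Y (x + h)], both on level [k], the mean value theorem in the second variable gives
    [(y' - y) / h = - (Phix x y + e) / L], where [e] tends to 0 and [L], a value of [Phiy] at a
    nearby point, tends to [Phiy x y]. *)
Lemma first_integral_level_curve (Phi Phix Phiy F : R -> R -> R) (a b m r k : R) :
  a <= b -> 0 < m -> 0 < r -> Rabs k < m * r ->
  (forall x, a <= x <= b -> Phi x 0 = 0) ->
  (forall x y, a <= x <= b -> Rabs y <= r ->
     is_derive (fun t => Phi t y) x (Phix x y) /\
     is_derive (Phi x) y (Phiy x y) /\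
     continuity_2d_pt Phiy x y /\
     m <= Phiy x y /\
     Phix x y + Phiy x y * F x y = 0) ->
  exists Y : R -> R,
    (forall x, a <= x <= b -> Phi x (Y x) = k) /\
    (forall x, a <= x <= b ->
      forall eps, 0 < eps -> exists d, 0 < d /\
        forall h, h <> 0 -> Rabs h < d -> a <= x + h <= b ->
          Rabs ((Y (x + h) - Y x) / h - F x (Y x)) < eps).
Proof.
  intros Hab Hm Hr Hk H0 HPhi.
  assert (S : forall x, {y | Rabs y <= r /\ Phi (clamp a b x) y = k}).
  { intros x; assert (Hx := clamp_in a b x Hab).
    apply (increasing_level _ (Phiy (clamp a b x)) m); auto.
    intros y Hy; destruct (HPhi _ _ Hx Hy) as [_ [D [_ [Hl _]]]]; auto. }
  set (Y := fun x => proj1_sig (S x)).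
  assert (HY : forall x, a <= x <= b -> Rabs (Y x) <= r /\ Phi x (Y x) = k).
  { intros x Hx; unfold Y; destruct (S x) as [y Hy]; simpl.
    now rewrite clamp_id in Hy. }
  exists Y; split; [intros x Hx; now apply HY |].
  intros x Hx eps Heps.
  destruct (HY x Hx) as [Hyr Hyk]; set (y := Y x) in *.
  destruct (HPhi x y Hx Hyr) as [Dx [_ [Cy [_ Eq]]]].
  assert (HF := Rabs_pos (F x y)).
  (* The final error is [(e + F x y * (L - Phiy x y)) / L] up to sign, with [L >= m], so each
     summand of the numerator may cost [eps * m / 2]. The [+ 1] keeps the denominator positive when
     [F x y = 0]. *)
  assert (He1 : 0 < eps * m / 2) by nra.
  assert (He2 : 0 < eps * m / 2 / (Rabs (F x y) + 1))
    by (apply Rdiv_lt_0_compat; lra).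
  apply is_derive_Reals in Dx.
  destruct (Dx _ He1) as [[d1 Hd1] D1]; simpl in D1.
  destruct (Cy (mkposreal _ He2)) as [[d2 Hd2] D2]; simpl in D2.
  (* [N] bounds [Rabs (Phix x y + e)], so [Rabs h < d2 * m / N] forces [Rabs (y' - y) < d2]:
     continuity of [Y] comes before its derivative. *)
  set (N := Rabs (Phix x y) + eps * m / 2).
  assert (HN : 0 < N) by (unfold N; assert (H := Rabs_pos (Phix x y)); lra).
  assert (Hd3 : 0 < d2 * m / N) by (apply Rdiv_lt_0_compat; nra).
  exists (Rmin d1 (Rmin d2 (d2 * m / N))); split.
  { repeat apply Rmin_pos; assumption. }
  intros h Hh0 Hhd Hxh.
  apply Rmin_Rgt_l in Hhd; destruct Hhd as [Hh1 Hhd].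
  apply Rmin_Rgt_l in Hhd; destruct Hhd as [Hh2 Hh3].
  destruct (HY _ Hxh) as [Hyr' Hyk']; set (y' := Y (x + h)) in *.
  assert (Hseg : forall t, Rmin y y' <= t <= Rmax y y' -> Rabs t <= r).
  { intros t Ht; apply Rabs_le.
    apply Rabs_le_between in Hyr; apply Rabs_le_between in Hyr'.
    revert Ht; unfold Rmin, Rmax; destruct Rle_dec; lra. }
  destruct (MVT_gen (Phi (x + h)) y y' (Phiy (x + h))) as [c [Hc E]].
  { intros t Ht; apply HPhi; [exact Hxh | apply Hseg; lra]. }
  { intros t Ht; apply derivable_continuous_pt.
    exists (Phiy (x + h) t); apply is_derive_Reals, HPhi; auto. }
  specialize (D1 h Hh0 Hh1).
  set (e := (Phi (x + h) y - Phi x y) / h - Phix x y) in D1.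
  assert (Ee : Phi (x + h) y = k + h * (Phix x y + e)).
  { unfold e; rewrite Hyk; field; exact Hh0. }
  destruct (HPhi _ c Hxh (Hseg c Hc)) as [_ [_ [_ [Hl _]]]].
  set (L := Phiy (x + h) c) in *.
  assert (Ek : y' - y = - h * (Phix x y + e) / L).
  { apply Rmult_eq_reg_l with L; [| lra].
    rewrite <- E, Hyk', Ee; field; lra. }
  assert (Hcy : Rabs (c - y) <= Rabs (y' - y)).
  { revert Hc; unfold Rmin, Rmax, Rabs; destruct Rle_dec;
      repeat destruct Rcase_abs; lra. }
  assert (HNe : Rabs (Phix x y + e) <= N).
  { eapply Rle_trans; [apply Rabs_triang | unfold N; lra]. }
  assert (Hky : Rabs (y' - y) < d2).
  { rewrite Ek; unfold Rdiv; rewrite !Rabs_mult, Rabs_Ropp, Rabs_inv, (Rabs_right L) by lra.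
    apply Rmult_lt_reg_r with L; [lra |].
    rewrite Rmult_assoc, Rinv_l, Rmult_1_r by lra.
    apply Rle_lt_trans with (Rabs h * N).
    { apply Rmult_le_compat_l; [apply Rabs_pos | exact HNe]. }
    apply Rlt_le_trans with (d2 * m / N * N).
    { apply Rmult_lt_compat_r; lra. }
    replace (d2 * m / N * N) with (d2 * m) by (field; lra).
    apply Rmult_le_compat_l; lra. }
  assert (HL : Rabs (L - Phiy x y) < eps * m / 2 / (Rabs (F x y) + 1)).
  { apply D2; [| lra]; now replace (x + h - x) with h by ring. }
  replace ((y' - y) / h - F x y) with (- (e + F x y * (L - Phiy x y)) / L).
  2:{ rewrite Ek; apply Rmult_eq_reg_l with L; [| lra].
      replace (Phix x y) with (- (Phiy x y * F x y)) by lra; field; split; lra. }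
  unfold Rdiv; rewrite Rabs_mult, Rabs_Ropp, Rabs_inv, (Rabs_right L) by lra.
  apply Rmult_lt_reg_r with L; [lra |].
  rewrite Rmult_assoc, Rinv_l, Rmult_1_r by lra.
  apply Rle_lt_trans with (Rabs e + Rabs (F x y) * Rabs (L - Phiy x y)).
  { rewrite <- Rabs_mult; apply Rabs_triang. }
  assert (HFL : Rabs (F x y) * Rabs (L - Phiy x y) <= eps * m / 2).
  { apply Rle_trans with ((Rabs (F x y) + 1) * (eps * m / 2 / (Rabs (F x y) + 1))).
    - apply Rmult_le_compat; try apply Rabs_pos; lra.
    - right; field; lra. }
  assert (eps * m <= eps * L) by (apply Rmult_le_compat_l; lra).
  lra.
Qed.

(** * The first integral *)

Definition b1 (x : R) : R := 10 * x ^ 5 - 14 * x ^ 3 + 4 * x.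
Definition b0 (x : R) : R :=
  25 * x ^ 10 - 70 * x ^ 8 + 202 / 3 * x ^ 6 - 24 * x ^ 4 + x ^ 2 + 2 / 3.
Definition c1 (x : R) : R := 8 * x ^ 5 - 12 * x ^ 3 + 4 * x.
Definition c0 (x : R) : R :=
  15 * x ^ 10 - 87 / 2 * x ^ 8 + 44 * x ^ 6 - 17 * x ^ 4 + x ^ 2 + 1 / 2.

Definition b1' (x : R) : R := 50 * x ^ 4 - 42 * x ^ 2 + 4.
Definition b0' (x : R) : R :=
  250 * x ^ 9 - 560 * x ^ 7 + 404 * x ^ 5 - 96 * x ^ 3 + 2 * x.
Definition c1' (x : R) : R := 40 * x ^ 4 - 36 * x ^ 2 + 4.
Definition c0' (x : R) : R :=
  150 * x ^ 9 - 348 * x ^ 7 + 264 * x ^ 5 - 68 * x ^ 3 + 2 * x.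

Definition quad (u1 u0 y : R) : R := 1 + u1 * y + u0 * y ^ 2.
Definition bb (x y : R) : R := quad (b1 x) (b0 x) y.
Definition cc (x y : R) : R := quad (c1 x) (c0 x) y.

Definition Phi (x y : R) : R := y * (cc x y * sqrt (cc x y)) / bb x y ^ 2.

(** The derivative of [u c^(3/2) / b^2] with [sqrt c / b^3] factored out; the remaining bracket is
    polynomial. It serves for both partial derivatives of [Phi]. *)
Definition dphi (u du c dc b db : R) : R :=
  sqrt c / b ^ 3 * ((du * c + 3 / 2 * u * dc) * b - 2 * u * c * db).

Definition Phix (x y : R) : R :=
  dphi y 0 (cc x y) (c1' x * y + c0' x * y ^ 2) (bb x y) (b1' x * y + b0' x * y ^ 2).
Definition Phiy (x y : R) : R :=
  dphi y 1 (cc x y) (c1 x + 2 * c0 x * y) (bb x y) (b1 x + 2 * b0 x * y).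

Lemma is_derive_dphi (u c b : R -> R) (x du dc db : R) :
  is_derive u x du -> is_derive c x dc -> is_derive b x db ->
  0 < c x -> 0 < b x ->
  is_derive (fun t => u t * (c t * sqrt (c t)) / b t ^ 2) x
    (dphi (u x) du (c x) dc (b x) db).
Proof.
  intros Du Dc Db Hc Hb.
  assert (Hs := sqrt_lt_R0 _ Hc).
  auto_derive.
  { repeat split; try (eexists; eassumption); try assumption.
    apply Rgt_not_eq; nra. }
  replace (Derive (fun t : R => u t) x) with du
    by (symmetry; exact (is_derive_unique _ _ _ Du)).
  replace (Derive (fun t : R => c t) x) with dc
    by (symmetry; exact (is_derive_unique _ _ _ Dc)).
  replace (Derive (fun t : R => b t) x) with db
    by (symmetry; exact (is_derive_unique _ _ _ Db)).
  unfold dphi.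
  (* Writing [c x] as the square of [s] turns the goal into a rational identity that [field]
     decides. *)
  assert (E : c x = sqrt (c x) * sqrt (c x)) by (rewrite sqrt_sqrt; lra).
  set (s := sqrt (c x)) in *.
  rewrite E; field; lra.
Qed.

Lemma pow_le_1_abs (x : R) (n : nat) : Rabs x <= 1 -> Rabs (x ^ n) <= 1.
Proof.
  intros Hx; rewrite <- RPow_abs, <- (pow1 n).
  apply pow_incr; split; [apply Rabs_pos | exact Hx].
Qed.

(** On [[-1, 1]] every power of [x] has absolute value at most 1, so the sum of the absolute values
    of the coefficients is a bound; 28 and 200 dominate these sums. *)
Lemma coefficient_bounds (x : R) :
  -1 <= x <= 1 ->
  -28 <= b1 x <= 28 /\ -200 <= b0 x <= 200 /\
  -28 <= c1 x <= 28 /\ -200 <= c0 x <= 200.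
Proof.
  intros Hx.
  assert (H : forall n, -1 <= x ^ n <= 1).
  { intros n; apply Rabs_le_between, pow_le_1_abs, Rabs_le_between; exact Hx. }
  unfold b1, b0, c1, c0.
  assert (H2 := H 2%nat); assert (H3 := H 3%nat); assert (H4 := H 4%nat);
  assert (H5 := H 5%nat); assert (H6 := H 6%nat); assert (H8 := H 8%nat);
  assert (H10 := H 10%nat).
  repeat split; lra.
Qed.

Lemma quad_bounds (u1 u0 y : R) :
  -28 <= u1 <= 28 -> -200 <= u0 <= 200 -> Rabs y <= 1 / 1000 ->
  97 / 100 <= quad u1 u0 y <= 103 / 100 /\
  -3 / 100 <= y * (u1 + 2 * u0 * y) <= 3 / 100.
Proof.
  intros H1 H0 Hy; apply Rabs_le_between in Hy; unfold quad.
  assert (A : -28 / 1000 <= u1 * y <= 28 / 1000) by (split; nra).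
  assert (B0 : 0 <= y ^ 2 <= 1 / 1000000) by (split; nra).
  assert (B : -2 / 10000 <= u0 * y ^ 2 <= 2 / 10000) by (split; nra).
  replace (y * (u1 + 2 * u0 * y)) with (u1 * y + 2 * (u0 * y ^ 2)) by ring.
  lra.
Qed.

(** At [y = 0], [c = b = 1] the value is 1. The tolerances leave a bracket of at least 8/10, a root
    of at least 97/100 and [b^3] of at most 11/10, which is ample for 1/2. *)
Lemma dphi_lower_bound (y c dc b db : R) :
  97 / 100 <= c <= 103 / 100 -> 97 / 100 <= b <= 103 / 100 ->
  -3 / 100 <= y * dc <= 3 / 100 -> -3 / 100 <= y * db <= 3 / 100 ->
  1 / 2 <= dphi y 1 c dc b db.
Proof.
  intros Hc Hb Hdc Hdb; unfold dphi.
  assert (Hs : 97 / 100 <= sqrt c).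
  { rewrite <- (sqrt_square (97 / 100)) by lra; apply sqrt_le_1; lra. }
  replace ((1 * c + 3 / 2 * y * dc) * b - 2 * y * c * db)
    with ((c + 3 / 2 * (y * dc)) * b - 2 * c * (y * db)) by ring.
  set (e := y * dc) in *; set (g := y * db) in *.
  assert (HN : 8 / 10 <= (c + 3 / 2 * e) * b - 2 * c * g).
  { assert (9 / 10 * (97 / 100) <= (c + 3 / 2 * e) * b)
      by (apply Rmult_le_compat; lra).
    assert (c * g <= 103 / 100 * (3 / 100)) by nra.
    lra. }
  set (N := (c + 3 / 2 * e) * b - 2 * c * g) in *.
  assert (Hb3 : 0 < b ^ 3 <= 11 / 10).
  { split; [apply pow_lt; lra |].
    apply Rle_trans with ((103 / 100) ^ 3); [apply pow_incr |]; lra. }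
  apply Rmult_le_reg_r with (b ^ 3); [lra |].
  replace (sqrt c / b ^ 3 * N * b ^ 3) with (sqrt c * N) by (field; lra).
  assert (97 / 100 * (8 / 10) <= sqrt c * N) by (apply Rmult_le_compat; lra).
  lra.
Qed.

Lemma continuity_2d_pt_quad (u1 u0 : R -> R) (x y : R) :
  continuity u1 -> continuity u0 ->
  continuity_2d_pt (fun x y => quad (u1 x) (u0 x) y) x y.
Proof.
  intros H1 H0; unfold quad.
  apply continuity_2d_pt_plus; [apply continuity_2d_pt_plus |].
  - apply continuity_2d_pt_const.
  - apply continuity_2d_pt_mult.
    + apply (continuity_1d_2d_pt_comp u1 (fun x _ => x)); [apply H1 | apply continuity_2d_pt_id1].
    + apply continuity_2d_pt_id2.
  - apply continuity_2d_pt_mult.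
    + apply (continuity_1d_2d_pt_comp u0 (fun x _ => x)); [apply H0 | apply continuity_2d_pt_id1].
    + apply (continuity_1d_2d_pt_comp (fun t => t ^ 2) (fun _ y => y));
        [reg | apply continuity_2d_pt_id2].
Qed.

Lemma continuity_2d_pt_quad_derive (u1 u0 : R -> R) (x y : R) :
  continuity u1 -> continuity u0 ->
  continuity_2d_pt (fun x y => u1 x + 2 * u0 x * y) x y.
Proof.
  intros H1 H0.
  apply continuity_2d_pt_plus; [| apply continuity_2d_pt_mult;
    [apply continuity_2d_pt_mult |]].
  - apply (continuity_1d_2d_pt_comp u1 (fun x _ => x)); [apply H1 | apply continuity_2d_pt_id1].
  - apply continuity_2d_pt_const.
  - apply (continuity_1d_2d_pt_comp u0 (fun x _ => x)); [apply H0 | apply continuity_2d_pt_id1].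
  - apply continuity_2d_pt_id2.
Qed.

Lemma continuity_2d_pt_Phiy (x y : R) :
  0 < bb x y -> 0 < cc x y -> continuity_2d_pt Phiy x y.
Proof.
  intros Hb Hc.
  assert (Kb1 : continuity b1) by (unfold b1; reg).
  assert (Kb0 : continuity b0) by (unfold b0; reg).
  assert (Kc1 : continuity c1) by (unfold c1; reg).
  assert (Kc0 : continuity c0) by (unfold c0; reg).
  assert (Cb : continuity_2d_pt bb x y) by now apply continuity_2d_pt_quad.
  assert (Cc : continuity_2d_pt cc x y) by now apply continuity_2d_pt_quad.
  assert (Db := continuity_2d_pt_quad_derive b1 b0 x y Kb1 Kb0).
  assert (Dc := continuity_2d_pt_quad_derive c1 c0 x y Kc1 Kc0).
  assert (Hc0 : forall k, continuity_2d_pt (fun _ _ => k) x y)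
    by (intros; apply continuity_2d_pt_const).
  assert (Hy := continuity_2d_pt_id2 x y).
  unfold Phiy, dphi.
  apply continuity_2d_pt_mult.
  - apply continuity_2d_pt_mult.
    + apply (continuity_1d_2d_pt_comp sqrt cc); [| exact Cc].
      apply continuity_pt_sqrt; lra.
    + apply continuity_2d_pt_inv.
      * apply (continuity_1d_2d_pt_comp (fun t => t ^ 3) bb); [reg | exact Cb].
      * apply pow_nonzero; lra.
  - apply continuity_2d_pt_minus;
      repeat first [assumption | apply Hc0 | apply continuity_2d_pt_plus
                   | apply continuity_2d_pt_mult].
Qed.

Lemma Phi_first_integral (x y : R) :
  -1 <= x <= 1 -> Rabs y <= 1 / 1000 ->
  is_derive (fun t => Phi t y) x (Phix x y) /\
  is_derive (Phi x) y (Phiy x y) /\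
  continuity_2d_pt Phiy x y /\
  1 / 2 <= Phiy x y /\
  Phix x y + Phiy x y * (p_ex x * y ^ 2 + q_ex x * y ^ 3) = 0.
Proof.
  intros Hx Hy.
  destruct (coefficient_bounds x Hx) as [B1 [B0 [C1 C0]]].
  destruct (quad_bounds _ _ _ B1 B0 Hy) as [Bb Bd].
  destruct (quad_bounds _ _ _ C1 C0 Hy) as [Cb Cd].
  fold (bb x y) in Bb; fold (cc x y) in Cb.
  split; [| split; [| split; [| split]]].
  - apply (is_derive_dphi (fun _ => y) (fun t => cc t y) (fun t => bb t y));
      try lra.
    + apply @is_derive_const.
    + unfold cc, quad, c1, c0, c1', c0'; auto_derive; [exact I | field].
    + unfold bb, quad, b1, b0, b1', b0'; auto_derive; [exact I | field].
  - apply (is_derive_dphi (fun t => t) (fun t => cc x t) (fun t => bb x t));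
      try lra.
    + apply @is_derive_id.
    + unfold cc, quad; auto_derive; [exact I | ring].
    + unfold bb, quad; auto_derive; [exact I | ring].
  - apply continuity_2d_pt_Phiy; lra.
  - now apply dphi_lower_bound.
  - unfold Phix, Phiy, dphi.
    (* Once [sqrt c / b^3] is pulled out, a polynomial identity in [x] and [y] remains. It expresses
       the cofactor ratio: in [z = 1 / y] the function [Phi] is [(z^2 c)^(3/2) / (z^2 b)^2], all
       other powers of [z] cancelling. *)
    match goal with |- ?s / ?d * ?A + ?s / ?d * ?B * ?f = 0 =>
      replace (s / d * A + s / d * B * f) with (s / d * (A + B * f)) by ring;
      replace (A + B * f) with 0; [ring |] end.
    unfold bb, cc, quad, b1, b0, c1, c0, b1', b0', c1', c0', p_ex, q_ex.
    field.
Qed.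

Lemma Phi_endpoint (x y : R) : x = -1 \/ x = 1 -> Phi x y = y.
Proof.
  intros Hx; unfold Phi.
  assert (Hb : bb x y = 1).
  { unfold bb, quad, b1, b0; destruct Hx; subst x; field. }
  assert (Hc : cc x y = 1).
  { unfold cc, quad, c1, c0; destruct Hx; subst x; field. }
  rewrite Hb, Hc, sqrt_1; field.
Qed.

Lemma has_center_ex : has_center p_ex q_ex (-1) 1.
Proof.
  (* The product [m * r] of the lower bound on [Phiy] and the radius: levels below it are attained
     for every [x]. *)
  exists (1 / 2 * (1 / 1000)); split; [lra |].
  intros y0 Hy0.
  destruct (first_integral_level_curve Phi Phix Phiy
              (fun x y => p_ex x * y ^ 2 + q_ex x * y ^ 3)
              (-1) 1 (1 / 2) (1 / 1000) y0) as [Y [HY HS]]; try lra.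
  { intros x _; unfold Phi, Rdiv; ring. }
  { exact Phi_first_integral. }
  assert (Ym := HY (-1) ltac:(lra)); rewrite Phi_endpoint in Ym by auto.
  assert (Yp := HY 1 ltac:(lra)); rewrite Phi_endpoint in Yp by auto.
  split.
  - exists Y; split; [exact HS | exact Ym].
  - intros y Hy E.
    rewrite (abel_solution_unique p_ex q_ex (-1) 1 y Y);
      [lra | lra | unfold p_ex; reg | unfold q_ex; reg | exact Hy | exact HS | lra].
Qed.

(** * Failure of the composition condition *)

Lemma is_integral_primitive (f F : R -> R) (a x : R) :
  (forall t, is_derive F t (f t)) -> continuity f ->
  is_integral f a x (F x - F a).
Proof.
  intros HF Hf.
  assert (H : is_RInt f a x (F x - F a)).
  { apply (is_RInt_derive F f); intros t _; [apply HF |].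
    apply continuity_pt_filterlim, Hf. }
  exists (ex_RInt_Reals_0 f a x (ex_intro _ _ H)).
  rewrite <- RInt_Reals; exact (is_RInt_unique _ _ _ _ H).
Qed.

Definition P_ex (x : R) : R := 8 * x ^ 5 - 10 * x ^ 3 + 2 * x.
(** The constant 7/12 makes this primitive vanish at -1. *)
Definition Q_ex (x : R) : R :=
  15 / 2 * x ^ 10 - 75 / 4 * x ^ 8 + 44 / 3 * x ^ 6 - 5 / 2 * x ^ 4
  - 3 / 2 * x ^ 2 + 7 / 12.

Lemma is_integral_p_ex (x : R) : is_integral p_ex (-1) x (P_ex x).
Proof.
  replace (P_ex x) with (P_ex x - P_ex (-1)) by (unfold P_ex; ring).
  apply is_integral_primitive; [| unfold p_ex; reg].
  intros t; unfold P_ex, p_ex; auto_derive; [exact I | ring].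
Qed.

Lemma is_integral_q_ex (x : R) : is_integral q_ex (-1) x (Q_ex x).
Proof.
  replace (Q_ex x) with (Q_ex x - Q_ex (-1)) by (unfold Q_ex; field).
  apply is_integral_primitive; [| unfold q_ex; reg].
  intros t; unfold Q_ex, q_ex; auto_derive; [exact I | field].
Qed.

Lemma peval_continuous (l : list R) : continuity (peval l).
Proof.
  induction l as [| c l IH]; simpl.
  - intros x; apply continuity_pt_const; intros ? ?; reflexivity.
  - intros x; apply continuity_pt_plus.
    + apply continuity_pt_const; intros ? ?; reflexivity.
    + apply continuity_pt_mult; [apply continuity_pt_id | apply IH].
Qed.

Lemma P_ex_roots (x : R) : P_ex x = 0 -> 0 <= x -> x = 0 \/ x = 1 / 2 \/ x = 1.
Proof.
  intros H Hx.
  assert (E : x * ((2 * x - 1) * ((x - 1) * ((2 * x + 1) * (x + 1)))) = 0).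
  { unfold P_ex in H; lra. }
  apply Rmult_integral in E; destruct E as [E | E]; [lra |].
  apply Rmult_integral in E; destruct E as [E | E]; [lra |].
  apply Rmult_integral in E; destruct E as [E | E]; [lra |].
  assert (0 < (2 * x + 1) * (x + 1)) by (apply Rmult_lt_0_compat; lra).
  lra.
Qed.

(* P = 2 x (4 x^2 - 1) (x^2 - 1) is nonnegative on [-1, -1/2], its three factors
   have absolute value at most 1 on [-1/2, 0], and P (4/5) = - 2808/3125. *)
Lemma P_ex_above (x : R) : -1 <= x <= 0 -> P_ex (4 / 5) < P_ex x.
Proof.
  intros Hx; unfold P_ex.
  replace (8 * x ^ 5 - 10 * x ^ 3 + 2 * x)
    with (- (2 * - x) * ((1 - 4 * x ^ 2) * (1 - x ^ 2))) by ring.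
  destruct (Rle_dec x (-1 / 2)) as [Hh | Hh].
  - assert (1 - 4 * x ^ 2 <= 0) by nra.
    assert (0 <= 1 - x ^ 2) by nra.
    assert ((1 - 4 * x ^ 2) * (1 - x ^ 2) <= 0) by nra.
    nra.
  - assert (0 <= 1 - 4 * x ^ 2 <= 1) by nra.
    assert (0 <= 1 - x ^ 2 <= 1) by nra.
    assert (0 <= (1 - 4 * x ^ 2) * (1 - x ^ 2) <= 1) by nra.
    nra.
Qed.

Lemma not_composition_ex : ~ composition_condition p_ex q_ex (-1) 1.
Proof.
  intros [w [f [g [Hw H]]]].
  assert (HP : forall x x', peval w x = peval w x' -> P_ex x = P_ex x').
  { intros x x' E.
    rewrite (proj1 (H x) _ (is_integral_p_ex x)), (proj1 (H x') _ (is_integral_p_ex x')).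
    now rewrite E. }
  assert (HQ : forall x x', peval w x = peval w x' -> Q_ex x = Q_ex x').
  { intros x x' E.
    rewrite (proj2 (H x) _ (is_integral_q_ex x)), (proj2 (H x') _ (is_integral_q_ex x')).
    now rewrite E. }
  assert (HI := fun a b y => IVT_gen (peval w) a b y (peval_continuous w)).
  (* The point 4/5 is close to where [P_ex] has its minimum over [[-1, 1]], which puts its value
     below all values on [[-1, 0]]. *)
  set (w0 := peval w 0); set (w4 := peval w (4 / 5)); set (w1 := peval w 1).
  assert (HM : Rmin w1 w0 <= w4 <= Rmax w1 w0 \/
               Rmin w4 w1 <= w0 <= Rmax w4 w1 \/
               Rmin w0 w4 <= w1 <= Rmax w0 w4).
  { unfold Rmin, Rmax; repeat destruct Rle_dec; lra. }
  destruct HM as [HM | [HM | HM]].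
  (* Replacing [w 1] by [w (-1)] moves the search to [[-1, 0]], away from the trivial solution
     4/5. *)
  - unfold w1 in HM; rewrite <- Hw in HM.
    destruct (HI _ _ _ HM) as [t [Ht E]].
    rewrite Rmin_left, Rmax_right in Ht by lra.
    assert (HPt := P_ex_above t Ht).
    specialize (HP _ _ E); lra.
  (* Here [t] lies in [[4/5, 1]], so the only root left is 1, where [Q_ex] is 0, while
     [Q_ex 0 = 7/12]. *)
  - destruct (HI _ _ _ HM) as [t [Ht E]].
    rewrite Rmin_left, Rmax_right in Ht by lra.
    assert (HPt : P_ex t = 0) by (rewrite (HP _ _ E); unfold P_ex; ring).
    specialize (HQ _ _ E).
    destruct (P_ex_roots t HPt) as [E' | [E' | E']]; try lra.
    rewrite E' in HQ; unfold Q_ex in HQ; lra.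
  (* Here [t] lies in [[0, 4/5]], leaving the roots 0 and 1/2; [Q_ex] is nonzero at both, while
     [Q_ex 1 = 0]. *)
  - destruct (HI _ _ _ HM) as [t [Ht E]].
    rewrite Rmin_left, Rmax_right in Ht by lra.
    assert (HPt : P_ex t = 0) by (rewrite (HP _ _ E); unfold P_ex; ring).
    specialize (HQ _ _ E).
    destruct (P_ex_roots t HPt) as [E' | [E' | E']]; try lra;
      rewrite E' in HQ; unfold Q_ex in HQ; lra.
Qed.

Theorem theorem2 :
  has_center p_ex q_ex (-1) 1 /\ ~ composition_condition p_ex q_ex (-1) 1.
Proof.
  exact (conj has_center_ex not_composition_ex).
Qed.
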